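(* The set $\mathrm{Sch}=\{X\in\mathrm{SF}\mid X\text{ is a Schwartz space}\}$ is Borel in $\mathrm{SF}$.
   Context: $C(\mathbb{R})$ is the Fréchet space of continuous real-valued functions on $\mathbb{R}$ with the topology of uniform convergence on compact sets. $\mathrm{SF}=\{X\subseteq C(\mathbb{R})\mid X\text{ is a closed vector subspace}\}$ with the Effros Borel structure, i.e., the $\sigma$-algebra generated by the sets $\{X\in\mathrm{SF}\mid X\cap U\neq\emptyset\}$, $U\subseteq C(\mathbb{R})$ open; it is a standard Borel space. Let $X$ be a Fréchet space. A set $K\subseteq X$ is totally bounded with respect to a neighborhood $U$ of zero if for all $\varepsilon>0$ there exist $x_1,\dots,x_n\in X$ with $K\subseteq\bigcup_{i=1}^n(x_i+\varepsilon U)$. $X$ is a Schwartz space if for every neighborhood $U$ of zero there is a neighborhood $V$ of zero which is totally bounded with respect to $U$. *)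

(* Defs.v *)
From HB Require Import structures.
From mathcomp Require Import all_boot all_order all_algebra.
From mathcomp Require Import all_classical all_reals all_analysis.
From mathcomp Require Import ring lra.

Set Implicit Arguments.
Unset Strict Implicit.
Unset Printing Implicit Defensive.

Import Order.TTheory GRing.Theory Num.Theory.
Import numFieldNormedType.Exports.

Local Open Scope classical_set_scope.
Local Open Scope ring_scope.

(* C(R); aliased because continuousType carries no default topology. *)
Definition CR (R : realType) : Type := continuousType R R^o.

Section CR_lmodule.
Context (R : realType).

HB.instance Definition _ := Choice.on (CR R).

Definition CR_fun (f : CR R) : R -> R^o := (f : continuousType R R^o).

Definition continuous_pred : {pred (R -> R^o)} :=
  mem [set f : R -> R^o | continuous f].

Definition CR_Sub (f : R -> R^o) (fP : f \in continuous_pred) : CR R :=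
  mkcts (set_mem fP).

Lemma CR_rect (K : CR R -> Type) :
  (forall f (fP : f \in continuous_pred), K (CR_Sub fP)) -> forall u, K u.
Proof.
move=> KSub u.
have uP : CR_fun u \in continuous_pred by apply: mem_set; exact: cts_fun.
suff -> : u = CR_Sub uP by exact: KSub.
by apply/(@continuousEP R R^o).
Qed.

Lemma CR_valP f (fP : f \in continuous_pred) : CR_fun (CR_Sub fP) = f.
Proof. by []. Qed.

HB.instance Definition _ := isSub.Build _ _ (CR R) CR_rect CR_valP.

Lemma continuous_submod_closed : submod_closed continuous_pred.
Proof.
split=> [|a f g /set_mem/= fc /set_mem/= gc]; apply/mem_set => x /=.
  exact: cvg_cst.
by apply: cvgD; [apply: cvgZl_tmp; exact: fc|exact: gc].
Qed.

HB.instance Definition _ := GRing.isSubmodClosed.Build _ _ continuous_pred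
  continuous_submod_closed.

HB.instance Definition _ := [SubChoice_isSubLmodule of CR R by <:].

(* Uniform convergence on compact sets; CR_nbhsP spells out the neighborhoods. *)
HB.instance Definition _ := Uniform.copy (CR R)
  (initial_topology (CR_fun : CR R -> {family compact, R -> R^o})).

Lemma CR_nbhsP (f : CR R) (A : set (CR R)) : nbhs f A <->
  exists K (e : R), [/\ compact K, 0 < e &
    [set g : CR R | forall x, K x -> `|CR_fun f x - CR_fun g x| < e] `<=` A].
Proof.
split=> [|[K [e [cK e0 KeA]]]].
  pose D : set (set R * R) := [set Ke | compact Ke.1 /\ 0 < Ke.2].
  pose B (Ke : set R * R) : set (R -> R^o) :=
    [set g | forall x, Ke.1 x -> `|CR_fun f x - g x| < Ke.2].
  have FF : Filter (filter_from D B).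
    apply: filter_from_filter; first by exists (set0, 1); split=> //=; exact: compact0.
    move=> [K1 e1] [K2 e2] [/= cK1 e10] [/= cK2 e20].
    exists (K1 `|` K2, Num.min e1 e2).
      by split=> /=; [exact: compactU|rewrite lt_min e10].
    move=> g /= gB; split=> x /= Kx.
      by have /gB : (K1 `|` K2) x; [left|rewrite lt_min => /andP[]].
    by have /gB : (K1 `|` K2) x; [right|rewrite lt_min => /andP[]].
  have cvgF : {family compact, filter_from D B --> CR_fun f}.
    apply/fam_cvgP => K cK P /uniform_nbhs[E [entE EP]].
    move: entE; rewrite -entourage_ballE => -[e /= e0 eE].
    exists (K, e) => // g /= gB; apply: EP => x Kx; apply: eE => /=.
    by rewrite -ball_normE; exact: gB.
  move=> [_ [[C oC <-] Cf CA]].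
  have [[K e] [cK e0] KeC] : filter_from D B C.
    by apply: cvgF; exact: open_nbhs_nbhs.
  by exists K, e; split=> // g gK; apply: CA; exact: KeC.
apply: (filterS KeA).
have nf : nbhs (CR_fun f : {family compact, R -> R^o})
    [set g : R -> R^o | forall x, K x -> ball (CR_fun f x) e (g x)].
  apply: (@fam_nbhs _ _ _ _ [set xy : R^o * R^o | ball xy.1 e xy.2]) => //.
  by rewrite -entourage_ballE; exists e.
have {}nf : nbhs f [set g : CR R |
    forall x, K x -> ball (CR_fun f x) e (CR_fun g x)] :=
  @initial_continuous (CR R) {family compact, R -> R^o} CR_fun f _ nf.
by apply: (@filterS _ _ _ _ _ _ nf) => g /= gK x /gK; rewrite -ball_normE.
Qed.

Lemma CR_add_continuous : continuous (fun x : CR R * CR R => x.1 + x.2).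
Proof.
move=> [f g] A /CR_nbhsP[K [e [cK e0 KeA]]].
exists ([set h : CR R | forall x, K x -> `|CR_fun f x - CR_fun h x| < e / 2],
        [set h : CR R | forall x, K x -> `|CR_fun g x - CR_fun h x| < e / 2]).
  by split; apply/CR_nbhsP; exists K, (e / 2); split=> //; rewrite divr_gt0.
move=> [h k] /= [fh gk]; apply: KeA => x Kx /=.
rewrite (_ : CR_fun _ x - _ = (CR_fun f x - CR_fun h x) +
  (CR_fun g x - CR_fun k x)); last by rewrite addrACA -opprD.
rewrite [ltRHS]splitr (le_lt_trans (ler_normD _ _))// ltrD//.
  exact: fh.
exact: gk.
Qed.

Lemma CR_scale_continuous : continuous (fun z : R^o * CR R => z.1 *: z.2).
Proof.
move=> [a f] A /CR_nbhsP[K [e [cK e0 KeA]]].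
have [M [M0 fM]] : exists M : R, 0 < M /\ forall x, K x -> `|CR_fun f x| <= M.
  have : compact (CR_fun f @` K).
    apply: continuous_compact => //; apply: continuous_subspaceT.
    exact: (@cts_fun _ _ (f : continuousType R R^o)).
  move=> /(@compact_bounded R R^o)/ex_strict_bound_gt0 [M M0 fM].
  by exists M; split=> // x Kx; apply/ltW/fM; exists x.
pose N := `|a| + 1; have N0 : 0 < N by rewrite ltr_wpDl.
pose d := Num.min 1 (e / 2 / M).
have d0 : 0 < d by rewrite lt_min ltr01 !divr_gt0.
exists (ball (a : R^o) d,
    [set h : CR R | forall x, K x -> `|CR_fun f x - CR_fun h x| < e / 2 / N]).
  split; first exact: nbhsx_ballx.
  by apply/CR_nbhsP; exists K, (e / 2 / N); split=> //; rewrite !divr_gt0.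
move=> [b h] /= [+ fh]; rewrite -ball_normE/= lt_min => /andP[ab1 abM].
apply: KeA => x Kx /=.
rewrite (_ : CR_fun _ x - _ = (a - b) * CR_fun f x +
  b * (CR_fun f x - CR_fun h x)); last first.
  by rewrite mulrBl mulrBr addrA subrK.
rewrite [ltRHS]splitr (le_lt_trans (ler_normD _ _))// !normrM ltr_leD//.
  rewrite (le_lt_trans (ler_wpM2l (normr_ge0 _) (fM _ Kx)))//.
  by rewrite -ltr_pdivlMr.
have bN : `|b| <= N.
  rewrite -[b](subKr a) (le_trans (ler_normB _ _))// lerD2l; exact: ltW.
rewrite (le_trans (ler_wpM2r (normr_ge0 _) bN))// mulrC -ler_pdivlMr//.
exact/ltW/fh.
Qed.

Lemma CR_locally_convex : exists2 B : set_system (CR R),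
  (forall b, b \in B -> convex_set b) & basis B.
Proof.
exists [set B | open B /\ convex_set B].
  by move=> b /[!inE] -[].
split=> [B []//|f A /CR_nbhsP[K [e [cK e0 KeA]]] /=].
pose U := [set g : CR R | exists2 d, d < e &
  forall x, K x -> `|CR_fun f x - CR_fun g x| <= d].
exists U; last first.
  by move=> g [d de gd]; apply: KeA => x Kx; exact: le_lt_trans (gd _ Kx) de.
split; last by exists 0 => // x _; rewrite subrr normr0.
split.
  rewrite openE => g [d de gd]; apply/CR_nbhsP; exists K, ((e - d) / 2).
  split=> //; first by rewrite divr_gt0// subr_gt0.
  move=> h gh; exists ((d + e) / 2); first by rewrite midf_lt.
  move=> x Kx; rewrite -(subrKA (CR_fun g x)) (le_trans (ler_normD _ _))//.
  rewrite (_ : (d + e) / 2 = d + (e - d) / 2); last by field.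
  by rewrite lerD ?gd//; exact/ltW/gh.
move=> g h l /set_mem[d1 d1e gd] /set_mem[d2 d2e hd]; apply/mem_set.
exists (Num.max d1 d2); first by rewrite gt_max d1e.
move=> x Kx; have l1 : l%:num + (1 - l%:num) = 1 by rewrite addrC subrK.
rewrite (_ : _ - _ = l%:num * (CR_fun f x - CR_fun g x) +
    (1 - l%:num) * (CR_fun f x - CR_fun h x)); last first.
  by rewrite !mulrBr addrACA -mulrDl l1 mul1r opprD.
rewrite (le_trans (ler_normD _ _))// !normrM.
rewrite (@ger0_norm _ l%:num)// (@ger0_norm _ (1 - l%:num)) ?subr_ge0//.
rewrite -[leRHS]mul1r -[X in _ <= X * _]l1 [leRHS]mulrDl.
by rewrite lerD// ler_wpM2l ?subr_ge0// le_max ?gd ?hd ?orbT.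
Qed.

HB.instance Definition _ :=
  PreTopologicalNmodule_isTopologicalNmodule.Build (CR R) CR_add_continuous.
HB.instance Definition _ :=
  TopologicalNmodule_isTopologicalLmodule.Build R (CR R) CR_scale_continuous.
HB.instance Definition _ :=
  Uniform_isTvs.Build R (CR R) CR_locally_convex.

End CR_lmodule.

Record SF (R : realType) := MkSF {
  SF_set :> set (CR R);
  SF_closed : closed SF_set;
  SF_submod : submod_closed (mem SF_set)
}.

Section SF_instances.
Context (R : realType).

HB.instance Definition _ := gen_eqMixin (SF R).
HB.instance Definition _ := gen_choiceMixin (SF R).

Lemma SF_setT_submod : submod_closed (mem [set: CR R]).
Proof. by split=> [|a f g _ _]; exact: mem_set. Qed.

(* g_sigma_algebraType only builds a measurableType over a pointedType. *)
HB.instance Definition _ := isPointed.Build (SF R)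
  (MkSF (@closedT (CR R)) SF_setT_submod).

End SF_instances.

(* The sigma-algebra generated by these sets is the Effros Borel structure. *)
Definition effros_generators (R : realType) : set (set (SF R)) :=
  [set [set X : SF R | X `&` U !=set0] | U in [set U : set (CR R) | open U]].

Section SF_space.
Context (R : realType) (X : SF R).

Definition SF_pred : {pred CR R} := mem (SF_set X).

HB.instance Definition _ :=
  GRing.isSubmodClosed.Build R (CR R) SF_pred (SF_submod X).

(* X itself as a topological vector space, with the topology induced by C(R). *)
Definition SF_space : Type := {f : CR R | f \in SF_pred}.

Definition SF_val (u : SF_space) : CR R := sval u.

HB.instance Definition _ := SubChoice.copy SF_space {f : CR R | f \in SF_pred}.

HB.instance Definition _ := [SubChoice_isSubLmodule of SF_space by <:].

HB.instance Definition _ := Uniform.copy SF_space (initial_topology SF_val).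

Lemma SF_val_continuous : continuous SF_val.
Proof. exact: initial_continuous. Qed.

Lemma SF_space_add_continuous :
  continuous (fun x : SF_space * SF_space => x.1 + x.2).
Proof.
move=> [u v] A [_ [[C oC <-] Cuv CA]].
have nC : nbhs (SF_val u + SF_val v) C by exact: open_nbhs_nbhs.
have [[P Q] /= [nP nQ] PQC] := @add_continuous (CR R) (SF_val u, SF_val v) _ nC.
exists (SF_val @^-1` P, SF_val @^-1` Q).
  by split; exact: SF_val_continuous.
by move=> [u' v'] /= [Pu Qv]; apply: CA; exact: (PQC (_, _)).
Qed.

Lemma SF_space_scale_continuous :
  continuous (fun z : R^o * SF_space => z.1 *: z.2).
Proof.
move=> [a v] A [_ [[C oC <-] Cav CA]].
have nC : nbhs (a *: SF_val v) C by exact: open_nbhs_nbhs.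
have [[P Q] /= [nP nQ] PQC] := @scale_continuous R (CR R) (a, SF_val v) _ nC.
exists (P, SF_val @^-1` Q).
  by split=> //; exact: SF_val_continuous.
by move=> [b v'] /= [Pb Qv]; apply: CA; exact: (PQC (_, _)).
Qed.

Lemma SF_space_locally_convex : exists2 B : set_system SF_space,
  (forall b, b \in B -> convex_set b) & basis B.
Proof.
have [B cB [oB bB]] := @locally_convex R (CR R).
exists [set SF_val @^-1` b | b in B].
  move=> _ /set_mem[b Bb <-] u v l /set_mem ub /set_mem vb; apply/mem_set.
  by apply/set_mem/(cB b); exact/mem_set.
split=> [_ [b Bb <-]|u A [_ [[C oC <-] Cu CA]]].
  by exists b => //; exact: oB.
have /bB[b [Bb bu] bC] : nbhs (SF_val u) C by exact: open_nbhs_nbhs.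
exists (SF_val @^-1` b); first by split=> //; exists b.
by move=> v bv; apply: CA; exact: bC.
Qed.

HB.instance Definition _ :=
  PreTopologicalNmodule_isTopologicalNmodule.Build SF_space
    SF_space_add_continuous.
HB.instance Definition _ :=
  TopologicalNmodule_isTopologicalLmodule.Build R SF_space
    SF_space_scale_continuous.
HB.instance Definition _ :=
  Uniform_isTvs.Build R SF_space SF_space_locally_convex.

End SF_space.

Definition totally_bounded_wrt (R : realType) (E : tvsType R) (U K : set E) :=
  forall e : R, 0 < e -> exists s : seq E,
    K `<=` \bigcup_(x in [set` s]) [set x + e *: u | u in U].

(* Stated for any locally convex space; it is only used for the members of SF,
   which are Frechet spaces as closed subspaces of C(R). *)
Definition schwartz (R : realType) (E : tvsType R) :=
  forall U : set E, nbhs 0 U ->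
    exists2 V : set E, nbhs 0 V & totally_bounded_wrt U V.

Definition Sch (R : realType) : set (SF R) :=
  [set X : SF R | schwartz (SF_space X)].

(* Main.v *)
Require Import Defs.
From mathcomp Require Import all_boot all_order all_algebra.
From mathcomp Require Import all_classical all_reals all_analysis.
From mathcomp Require Import ring lra.

Set Implicit Arguments.
Unset Strict Implicit.
Unset Printing Implicit Defensive.

Import Order.TTheory GRing.Theory Num.Theory.
Import numFieldNormedType.Exports.

Local Open Scope classical_set_scope.
Local Open Scope ring_scope.

(** Being Schwartz says that for every seminorm p_m, the supremum over [-m, m],
some basic neighborhood V_k of zero in X is p_m-totally bounded. The centers of
the covers that witness total boundedness may be taken outside X at the cost of
a factor 2 in the radius: a piece of the cover that meets X is contained in a
piece of twice the radius around any of its points in X. Centers can therefore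
come from one countable family that works for all X at once and is uniformly
dense on [-m, m], and they can even be discontinuous: here they are step
functions with rational values, which approximate every continuous function
uniformly by uniform continuity on [-m, m].

With V_k open in C(R) and with the closed tubes around the step functions as
pieces, a finite family F covers the trace of V_k on X at scale 1/(n+1) if and
only if X misses the open set of the points of V_k lying in no tube of F
([uncovered m k n F], [open_uncovered]). So for fixed m, k, n and F the
condition is the complement of a generator of the Effros structure, and
[schwartz_uncovered] writes Sch as a countable intersection of unions of
intersections of unions of such complements. *)

Section Schwartz_borel.
Context (R : realType).
Implicit Types (f g : CR R) (X : SF R) (m k n : nat).

(** Step function on [-m, m] with breakpoints -m + i / (c.1 + 1) and values read
off the list c.2; the codes c form a countable type. *)
Definition step_fun m (c : nat * seq rat) (x : R) : R :=
  ratr (nth 0 c.2 (Num.truncn ((x + m%:R) * c.1.+1%:R))).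

(** Uniform continuity on [-m, m]. The modulus is taken among the 1/(j+1), so
that compactness, in its near-covering form, turns local moduli that are good
for all large j into one modulus that is good on the whole segment. *)
Lemma CR_unif_continuous f m (e : R) : 0 < e ->
  exists j, forall x y : R, `|x| <= m%:R -> `|x - y| < j.+1%:R^-1 ->
    `|CR_fun f x - CR_fun f y| < e.
Proof.
move=> e0.
pose P j (x : R) :=
  forall y : R, `|x - y| < j.+1%:R^-1 -> `|CR_fun f x - CR_fun f y| < e.
have /compact_near_coveringP/(_ nat \oo P _) := @segment_compact R (- m%:R) m%:R.
case.
  move=> x _.
  have cf : CR_fun f z @[z --> (x : R)] --> CR_fun f x.
    exact: (@cts_fun _ _ (f : continuousType R R^o)).
  have e20 : 0 < e / 2 by rewrite divr_gt0.
  have nf : \forall z \near x, `|CR_fun f x - CR_fun f z| < e / 2.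
    exact: (@cvgr_dist_lt _ _ _ _ _ _ _ cf _ e20).
  have [d /= d0 dB] := (nbhs_ballP _ _).1 nf.
  have d20 : 0 < d / 2 by rewrite divr_gt0.
  exists (ball x (d / 2), [set j | j.+1%:R^-1 < d / 2]).
    split; first exact: nbhsx_ballx.
    exact: (near_infty_natSinv_lt (PosNum d20)).
  move=> [z j] [/= xz jd] y zy; move: xz; rewrite -ball_normE /= => xz.
  have fz : `|CR_fun f x - CR_fun f z| < e / 2.
    by apply: dB; rewrite -ball_normE/= (lt_trans xz)//; lra.
  have fy : `|CR_fun f x - CR_fun f y| < e / 2.
    apply: dB; rewrite -ball_normE/= -(subrKA z).
    rewrite (le_lt_trans (ler_normD _ _))// [ltRHS]splitr ltrD//.
    exact: lt_trans zy jd.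
  rewrite -(subrKA (CR_fun f x)) (le_lt_trans (ler_normD _ _))//.
  by rewrite [ltRHS]splitr ltrD// distrC.
move=> j _ jP; exists j => x y xm; apply: (jP j (leqnn _)).
by rewrite /= in_itv /= -ler_norml.
Qed.

(** Uniform density on [-m, m] of the countable family of step functions: sample
the function at the breakpoints of a mesh finer than a modulus of continuity for
e / 2, and round the samples to rationals with error e / 2. *)
Lemma step_fun_approx f m (e : R) : 0 < e ->
  exists c, forall x : R, `|x| <= m%:R -> `|CR_fun f x - step_fun m c x| <= e.
Proof.
move=> e0; have e20 : 0 < e / 2 by rewrite divr_gt0.
have [j jP] := CR_unif_continuous f m e20.
have J0 : 0 < j.+1%:R :> R by rewrite ltr0n.
pose t i : R := i%:R / j.+1%:R - m%:R.
have qP i : exists q : rat, `|CR_fun f (t i) - ratr q| <= e / 2.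
  have [q] := @rat_in_itvoo R (CR_fun f (t i) - e / 2) (CR_fun f (t i) + e / 2) ltac:(lra).
  by rewrite in_itv/= => /andP[q1 q2]; exists q; rewrite ler_distlC !ltW.
pose q i := sval (cid (qP i)).
(* One more value than there are steps: x = m is sent to index 2m(j+1). *)
exists (j, mkseq q (m * 2 * j.+1).+1) => x xm; rewrite /step_fun /=.
set i := Num.truncn _.
move: (xm); rewrite ler_norml => /andP[x1 x2].
have x0 : 0 <= (x + m%:R) * j.+1%:R by rewrite mulr_ge0//; lra.
have /andP[i1 i2] := truncn_itv x0.
rewrite -/i in i1 i2.
have im : (i < (m * 2 * j.+1).+1)%N.
  rewrite ltnS -(ler_nat R) (le_trans i1)// !natrM ler_wpM2r//; lra.
rewrite nth_mkseq //.
rewrite -(subrKA (CR_fun f (t i))) (le_trans (ler_normD _ _))//.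
rewrite [leRHS]splitr lerD//; last exact: svalP (cid (qP i)).
(* It remains that x is within one mesh width of its breakpoint t i. *)
apply/ltW/jP => //.
rewrite -(ltr_pM2r J0) mulVf ?gt_eqF// -[X in _ * X]gtr0_norm// -normrM.
rewrite (_ : _ * _ = (x + m%:R) * j.+1%:R - i%:R).
  by rewrite ltr_distlC; apply/andP; split; move: i2; rewrite -natr1; lra.
by rewrite /t; field; rewrite gt_eqF.
Qed.

Definition tube m (r : R) (s : R -> R) : set (CR R) :=
  [set g | forall x, `|x| <= m%:R -> `|CR_fun g x - s x| <= r].

Lemma closed_tube m r s : closed (tube m r s).
Proof.
rewrite -[tube _ _ _]setCK; apply: open_closedC; rewrite openE => g.
move=> /existsNP[x /not_implyP[xm /negP]]; rewrite -ltNge => gx.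
apply/CR_nbhsP; exists [set x], (`|CR_fun g x - s x| - r).
split; [exact: compact_set1|by rewrite subr_gt0|].
move=> h /= /(_ x erefl) gh /(_ x xm) hs.
have := ler_normD (CR_fun g x - CR_fun h x) (CR_fun h x - s x).
rewrite subrKA; lra.
Qed.

Definition sup_ball k : set (CR R) :=
  [set g | forall x, `|x| <= k%:R -> `|CR_fun g x| < k.+1%:R^-1].

(** The [sup_ball k] form a countable base at zero: one index k controls both
the radius and the segment, since a compact set is bounded. *)
Lemma CR_nbhs0P (A : set (CR R)) : nbhs 0 A <-> exists k, sup_ball k `<=` A.
Proof.
split=> [/CR_nbhsP[K [e [cK e0 KeA]]]|[k kA]]; last first.
  apply/CR_nbhsP; exists [set` `[- k%:R, k%:R]], k.+1%:R^-1; split.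
  - exact: segment_compact.
  - by rewrite invr_gt0.
  - move=> g gk; apply: kA => x xk.
    have := gk x; rewrite /= in_itv/= -ler_norml sub0r normrN; exact.
have [M M0 KM] : exists2 M : R, 0 < M & forall x, K x -> `|x| < M.
  exact: (ex_strict_bound_gt0 (@compact_bounded R R^o K cK)).
have [j je] := @ltr_add_invr R 0 e e0; rewrite add0r in je.
exists (maxn j (Num.truncn M).+1) => g gk; apply: KeA => x Kx.
rewrite sub0r normrN (lt_trans _ je)// (lt_le_trans (gk _ _))//.
  rewrite (le_trans (ltW (KM _ Kx)))// (le_trans (ltW (truncnS_gt _)))//.
  by rewrite ler_nat leq_maxr.
by rewrite lef_pV2 ?posrE// ler_nat ltnS leq_maxl.
Qed.

Lemma SF_space_nbhs0P X (A : set (SF_space X)) :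
  nbhs 0 A <-> exists k, @SF_val R X @^-1` sup_ball k `<=` A.
Proof.
split=> [[_ [[C oC <-] C0 CA]]|[k kA]].
  have /CR_nbhs0P[k kC] : nbhs 0 C by exact: open_nbhs_nbhs.
  by exists k => u uk; apply: CA; exact: kC.
apply: (filterS kA); apply: (@SF_val_continuous R X 0).
by apply/CR_nbhs0P; exists k.
Qed.

(** Interior is taken because it makes the first factor open for free and
leaves it a neighborhood of zero. *)
Definition uncovered m k n (F : seq (nat * seq rat)) : set (CR R) :=
  (sup_ball k)° `&`
  \bigcap_(c in [set` F]) ~` tube m n.+1%:R^-1 (step_fun m c).

Lemma open_uncovered m k n F : open (uncovered m k n F).
Proof.
apply: openI; first exact: open_interior.
rewrite bigcap_seq; elim/big_ind: _ => [|A B|c _]; first exact: openT.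
  exact: openI.
by apply: closed_openC; exact: closed_tube.
Qed.

(** Total boundedness passes from covers centered in X to covers by tubes around
step functions by approximating each center, and back by replacing each tube
that meets X with a ball around one of the points of X in it. *)
Lemma schwartz_uncovered X : schwartz (SF_space X) <->
  forall m, exists k, forall n, exists F, X `&` uncovered m k n F = set0.
Proof.
split=> [sX m|H U /SF_space_nbhs0P[m mU]].
  have [|V /SF_space_nbhs0P[k kV] tV] := sX (@SF_val R X @^-1` sup_ball m).
    by apply/SF_space_nbhs0P; exists m.
  (* Half of the tolerance goes to approximating the centers by step functions,
     half to the radius; sup_ball m has radius at most 1, so scaling it by d
     gives a radius at most d. *)
  exists k => n; pose d : R := n.+1%:R^-1 / 2.
  have d0 : 0 < d by rewrite divr_gt0.
  have [s sV] := tV d d0.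
  have cP (u : SF_space X) := cid (step_fun_approx (SF_val u) m d0).
  exists [seq sval (cP u) | u <- s].
  rewrite -subset0 => g [Xg [gk]] /=.
  have gP : g \in SF_pred X by exact/mem_set.
  have [|u /= us [v vm vg]] := sV (exist _ g gP : SF_space X).
    by apply: kV; exact: interior_subset.
  move=> /(_ (sval (cP u)) (map_f _ us)); apply=> x xm.
  have gE : g = SF_val u + d *: SF_val v by exact: (congr1 (@SF_val R X) (esym vg)).
  have -> : CR_fun g x = CR_fun (SF_val u) x + d * CR_fun (SF_val v) x.
    by rewrite gE.
  rewrite addrAC (le_trans (ler_normD _ _))//.
  rewrite (_ : n.+1%:R^-1 = d + d) /d; last by rewrite -splitr.
  rewrite lerD ?(svalP (cP u) _ xm)// normrM gtr0_norm// ger_pMr//.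
  rewrite (le_trans (ltW (vm _ xm)))// invf_le1 ?ler1n//.
have [k kP] := H m.
exists (@SF_val R X @^-1` (sup_ball k)°).
  apply: (@SF_val_continuous R X 0); apply: nbhs_interior.
  by apply/CR_nbhs0P; exists k.
move=> e e0.
(* Two points of a common tube differ by at most 2 / (n+1) on [-m, m], which
   must be less than the radius of e times sup_ball m. *)
have [n ne] : exists n, n.+1%:R^-1 + n.+1%:R^-1 < e / m.+1%:R.
  have e1 : 0 < e / m.+1%:R / 2 by rewrite !divr_gt0.
  have [n] := ltr_add_invr e1; rewrite add0r => nP.
  by exists n; rewrite [ltRHS]splitr ltrD.
have [F FP] := kP n.
(* The new center: a point of X in the tube of c, or 0 if there is none. *)
have pickP c : exists u : SF_space X, forall v : SF_space X,
    tube m n.+1%:R^-1 (step_fun m c) (SF_val v) ->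
    tube m n.+1%:R^-1 (step_fun m c) (SF_val u).
  have [[v vP]|nv] := pselect (exists v : SF_space X,
      tube m n.+1%:R^-1 (step_fun m c) (SF_val v)).
    by exists v.
  by exists 0 => v vP; case: nv; exists v.
pose pick c := cid (pickP c).
exists [seq sval (pick c) | c <- F] => v vk.
have [c cF vc] : exists2 c, c \in F &
    tube m n.+1%:R^-1 (step_fun m c) (SF_val v).
  apply: contrapT => nc; suff : set0 (SF_val v) by [].
  rewrite -FP; split; first exact: (set_mem (svalP v)).
  by split=> // c cF vc; apply: nc; exists c.
have uc := svalP (pick c) v vc.
exists (sval (pick c)); first exact: map_f.
set u := sval (pick c) in uc *.
exists (e^-1 *: (v - u)); last first.
  by rewrite scalerA divff ?gt_eqF// scale1r addrC subrK.
apply: mU => x xm.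
have -> : CR_fun (SF_val (e^-1 *: (v - u))) x =
  e^-1 * (CR_fun (SF_val v) x - CR_fun (SF_val u) x) by [].
rewrite normrM gtr0_norm ?invr_gt0// mulrC ltr_pdivrMr// mulrC.
apply: le_lt_trans ne; rewrite -(subrKA (step_fun m c x)).
rewrite (le_trans (ler_normD _ _))// lerD ?vc//.
by rewrite distrC uc.
Qed.

End Schwartz_borel.

Theorem theorem4p14 (R : realType) : (@effros_generators R).-sigma.-measurable (@Sch R).
Proof.
have -> : @Sch R = \bigcap_m \bigcup_k \bigcap_n \bigcup_F
    ~` [set X : SF R | X `&` uncovered m k n F !=set0].
  apply/seteqP; split=> X.
    move=> /schwartz_uncovered sX m _; have [k kP] := sX m.
    exists k => // n _; have [F FP] := kP n.
    by exists F => //; exact/nonemptyPn.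
  move=> sX; apply/schwartz_uncovered => m; have [k _ kP] := sX m I.
  by exists k => n; have [F _ /nonemptyPn FP] := kP n I; exists F.
apply: bigcapT_measurable => m; apply: bigcupT_measurable => k.
apply: bigcapT_measurable => n.
apply: countable_bigcupT_measurable => [|F]; first exact: countableP.
apply: measurableC; apply: sub_sigma_algebra.
by exists (uncovered m k n F) => //; exact: open_uncovered.
Qed.
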